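(* Assume that $R$ is finite and let $\mathcal C$ be a nonzero free $R$-submodule of $S[G]$, with image $\overline{\mathcal C}$ in $\overline S[G]$. Then $$d(\mathcal C)=d(\overline{\mathcal C})\quad\text{and}\quad \mathrm{rk}_{\mathrm{inn}}(\mathcal C,R)=\dim_{\overline R}(\overline{\mathcal C}).$$ Moreover, $\mathcal C$ is MRD in $S[G]$ if and only if $\overline{\mathcal C}$ is MRD in $\overline S[G]$.
   Context: Setting: $G=\langle\sigma\rangle$ is a cyclic group of order $n$. A $G$-Galois extension is an extension $S/R$ of commutative rings such that $G$ is a subgroup of $\mathrm{Aut}(S/R)$ (automorphisms of $S$ as $R$-algebra), $S^G=R$, and the map $S\otimes_R S\to\bigoplus_{g\in G}S$, $x\otimes y\mapsto (xg(y))_{g\in G}$, is bijective. $S/R$ is an unramified $G$-Galois extension of local principal ideal rings, meaning: there is a $G$-Galois extension $\tilde S/\tilde R$ of discrete valuation rings and $\omega\in\tilde R$ such that $\tilde R\omega$ and $\tilde S\omega$ are the maximal ideals of $\tilde R$ and $\tilde S$, and either $R=\tilde R$, $S=\tilde S$, or $R=\tilde R/\tilde R\omega^k$, $S=\tilde S/\tilde S\omega^k$ for some $k\geq 1$, with $G$ acting on $S$ by the induced automorphisms; then $S/R$ is $G$-Galois and $S$ is a free $R$-module of rank $n$. $\overline R$ and $\overline S$ are the residue fields of $R$ and $S$; the extension $\overline S/\overline R$ is $G$-Galois. $\overline{\mathcal C}$ is the image of $\mathcal C$ under the coefficientwise reduction $S[G]\to\overline S[G]$. $S[G]$ is the skew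 group algebra: the free $S$-module with basis $G$ and multiplication $(ag)(bh)=a\,g(b)\,gh$. It is identified with $\mathrm{End}_R(S)$ via $\sum_g a_g g\mapsto (x\mapsto\sum_g a_g g(x))$; likewise $\overline S[G]$ is identified with $\mathrm{End}_{\overline R}(\overline S)$. For a finitely generated $R$-module $M$, $\mathrm{rk}_{\mathrm{inn}}(M,R)$ is the minimal number of generators of $M$; for $f\in S[G]$ viewed in $\mathrm{End}_R(S)$, $\mathrm{rk}_{\mathrm{inn}}(f,R)=\mathrm{rk}_{\mathrm{inn}}(f(S),R)$ (over a field this is the usual rank). The minimum rank distance of an $R$-linear code (a nonzero $R$-submodule) $\mathcal C\subseteq S[G]$ is $d(\mathcal C)=\min\{\mathrm{rk}_{\mathrm{inn}}(f,R): f\in\mathcal C\setminus\{0\}\}$. The code $\mathcal C$ is called MRD (maximum rank distance) if it is a free $R$-submodule of $S[G]$ with $\mathrm{rk}_{\mathrm{inn}}(\mathcal C,R)=n(n-d(\mathcal C)+1)$. The same definitions are used for $\overline S/\overline R$. *)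

(* Defs.v *)
From HB Require Import structures.
From mathcomp Require Import all_boot all_order all_algebra all_fingroup all_field.
From mathcomp Require Import generic_quotient.
From mathcomp Require Import boolp classical_sets.

Set Implicit Arguments.
Unset Strict Implicit.
Unset Printing Implicit Defensive.

Import GRing.Theory.
Local Open Scope classical_set_scope.
Local Open Scope ring_scope.
Local Open Scope quotient_scope.

(* Submodules and ideals are classical sets; an ideal of a commutative ring A
   is a submodule of the regular module A^o. *)

Definition is_submodule (R : nzRingType) (V : lmodType R) (M : set V) : Prop :=
  submod_closed [pred v | v \in M].

Definition is_ideal (A : comNzRingType) (I : set A) : Prop :=
  @is_submodule A A^o I.

Definition maximal_ideal (A : comNzRingType) (I : set A) : Prop :=
  [/\ is_ideal I, I <> setT &
      forall J : set A, is_ideal J -> I `<=` J -> J <> setT -> J = I].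

Definition local_ring (A : comNzRingType) : Prop :=
  exists! m : set A, maximal_ideal m.

Definition principal_ideal (A : comNzRingType) (a : A) : set A :=
  [set x | exists y, x = y * a].

Definition principal_ideal_ring (A : comNzRingType) : Prop :=
  forall I : set A, is_ideal I -> exists a, I = principal_ideal a.

(* A discrete valuation ring is a local principal ideal domain which is not a
   field, that is, whose zero ideal is not maximal. *)
Definition dvr (A : comNzRingType) : Prop :=
  [/\ GRing.integral_domain_axiom A, principal_ideal_ring A, local_ring A
    & ~ maximal_ideal [set (0 : A)]].

(* For a local ring A, this says that pi identifies k with the residue field. *)
Definition residue_map (A : comNzRingType) (k : fieldType)
    (pi : {rmorphism A -> k}) : Prop :=
  range pi = setT /\ maximal_ideal [set x | pi x = 0].

Section Tensor.
Variables (R : comNzRingType) (S : comAlgType R).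

(* S (x)_R S as a quotient of the commutative monoid of formal sums of pure
   tensors, the pair (x, y) standing for x (x) y. Since
   (x, y) + (- x, y) ~ (0, y) ~ 0, the quotient is an abelian group. *)
Inductive tensor_eq : seq (S * S) -> seq (S * S) -> Prop :=
| tensor_eq_refl s : tensor_eq s s
| tensor_eq_sym s t : tensor_eq s t -> tensor_eq t s
| tensor_eq_trans s t u : tensor_eq s t -> tensor_eq t u -> tensor_eq s u
| tensor_eq_cat s s' t t' :
    tensor_eq s s' -> tensor_eq t t' -> tensor_eq (s ++ t) (s' ++ t')
| tensor_eq_catC s t : tensor_eq (s ++ t) (t ++ s)
| tensor_eq_zero y : tensor_eq [:: (0, y)] [::]
| tensor_eq_addl x x' y : tensor_eq [:: (x + x', y)] [:: (x, y); (x', y)]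
| tensor_eq_addr x y y' : tensor_eq [:: (x, y + y')] [:: (x, y); (x, y')]
| tensor_eq_scale (a : R) x y : tensor_eq [:: (a *: x, y)] [:: (x, a *: y)].

Definition tensor_eqb : rel (seq (S * S)) := fun s t => `[< tensor_eq s t >].

Lemma tensor_eqb_equiv : equiv_class_of tensor_eqb.
Proof.
split=> [s|s t|t s u].
- exact/asboolP/tensor_eq_refl.
- by apply/asboolP/asboolP; apply: tensor_eq_sym.
- move=> /asboolP st /asboolP tu; apply/asboolP; exact: tensor_eq_trans st tu.
Qed.

Canonical tensor_equiv := EquivRelPack tensor_eqb_equiv.

Definition tensor := {eq_quot tensor_equiv}.

End Tensor.

Section Galois.
Variables (gT : finGroupType) (R : comNzRingType) (S : comAlgType R).
Variable act : gT -> {lrmorphism S -> S}.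

(* G (the whole of gT) is a subgroup of Aut(S/R). *)
Definition galois_group_action : Prop :=
  [/\ forall x, act 1%g x = x,
      forall g h x, act (g * h)%g x = act g (act h x)
    & forall g, (forall x, act g x = x) -> g = 1%g].

Definition galois_sum (s : seq (S * S)) : {ffun gT -> S} :=
  [ffun g => \sum_(p <- s) p.1 * act g p.2].

(* x (x) y |-> (x * g y)_g *)
Definition galois_map (t : tensor S) : {ffun gT -> S} := galois_sum (repr t).

Lemma tensor_eq_galois_sum (s t : seq (S * S)) :
  tensor_eq s t -> galois_sum s = galois_sum t.
Proof.
move=> st; apply/ffunP=> g; rewrite !ffunE.
elim: st => //=.
- by move=> ? ? ? _ -> _ ->.
- by move=> ? ? ? ? _ e1 _ e2; rewrite !big_cat /= e1 e2.
- by move=> ? ?; rewrite !big_cat /= addrC.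
- by move=> y; rewrite big_cons !big_nil /= mul0r addr0.
- by move=> x x' y; rewrite !big_cons !big_nil /= !addr0 mulrDl.
- by move=> x y y'; rewrite !big_cons !big_nil /= !addr0 raddfD mulrDr.
- by move=> a x y; rewrite !big_cons !big_nil /= !addr0 linearZ /= -scalerAl -scalerAr.
Qed.

Lemma galois_mapE (s : seq (S * S)) :
  galois_map (\pi_(tensor S) s) = galois_sum s.
Proof.
apply: tensor_eq_galois_sum; apply/asboolP.
by have /eqmodP := reprK (\pi_(tensor S) s).
Qed.

Definition galois_extension : Prop :=
  [/\ galois_group_action,
      injective (fun a : R => a%:A : S),
      [set x | forall g, act g x = x] = range (fun a : R => a%:A : S)
    & bijective galois_map].

End Galois.

(* The isomorphisms R ~ R~/I and S ~ S~/IS~, for I = 0 or I = (w^k), are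
   expressed by surjections pR, pS with these kernels; their compatibility with
   the structure maps and with the actions says that the R-algebra structure of
   S and the action of G on S are the induced ones. *)
Definition unramified_galois (gT : finGroupType) (R : comNzRingType)
    (S : comAlgType R) (act : gT -> {lrmorphism S -> S}) : Prop :=
  exists (Rt : comNzRingType) (St : comAlgType Rt)
         (actt : gT -> {lrmorphism St -> St}) (w : Rt)
         (pR : {rmorphism Rt -> R}) (pS : {rmorphism St -> S}),
    [/\ [/\ dvr Rt, dvr St & galois_extension actt],
        maximal_ideal (principal_ideal w)
          /\ maximal_ideal (principal_ideal (w%:A : St)),
        range pR = setT /\ range pS = setT,
        (forall a, pS a%:A = (pR a)%:A)
          /\ (forall g x, pS (actt g x) = act g (pS x))
      & ([set a | pR a = 0] = [set 0] /\ [set x | pS x = 0] = [set 0])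
        \/ exists k : nat,
             [/\ (1 <= k)%N,
                 [set a | pR a = 0] = principal_ideal (w ^+ k)
               & [set x | pS x = 0] = principal_ideal ((w ^+ k)%:A : St)]].

(* The least natural number in P (0 if P is empty). *)
Definition least (P : set nat) : nat :=
  xget 0%N [set r | P r /\ forall m, P m -> (r <= m)%N].

Section Modules.
Variables (R : comNzRingType) (V : lmodType R).

Definition spanned (r : nat) (e : 'I_r -> V) : set V :=
  range (fun a : 'I_r -> R => \sum_i a i *: e i).

(* Meaningful for finitely generated submodules M only. *)
Definition rk_inn (M : set V) : nat :=
  least [set r | exists e : 'I_r -> V, M = spanned e].

Definition linearly_independent (r : nat) (e : 'I_r -> V) : Prop :=
  forall a : 'I_r -> R, \sum_i a i *: e i = 0 -> forall i, a i = 0.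

Definition free_submodule (M : set V) : Prop :=
  exists (r : nat) (e : 'I_r -> V), linearly_independent e /\ M = spanned e.

Definition linear_code (C : set V) : Prop := is_submodule C /\ C <> [set 0].

End Modules.

(* S[G]: the function f stands for \sum_g (f g) g. The R-module structure is
   that of {ffun gT -> S}, but the product is skew_mul, not the pointwise one. *)
Definition skew_group_algebra (gT : finGroupType) (R : comNzRingType)
  (S : comAlgType R) : lmodType R := {ffun gT -> S}.

Section SkewGroupAlgebra.
Variables (gT : finGroupType) (R : comNzRingType) (S : comAlgType R).
Variable act : gT -> {lrmorphism S -> S}.
Local Notation SG := (skew_group_algebra gT S).

Definition skew_mul (a b : {ffun gT -> S}) : {ffun gT -> S} :=
  [ffun k => \sum_g a g * act g (b (g^-1 * k)%g)].

(* The identification of S[G] with End_R(S). *)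
Definition skew_eval (f : {ffun gT -> S}) (x : S) : S := \sum_g f g * act g x.

Lemma skew_eval_mul (a b : {ffun gT -> S}) x : galois_group_action act ->
  skew_eval (skew_mul a b) x = skew_eval a (skew_eval b x).
Proof.
case=> _ actM _; rewrite /skew_eval.
under eq_bigr => k _ do rewrite ffunE mulr_suml.
rewrite exchange_big /=; apply: eq_bigr => g _.
rewrite raddf_sum mulr_sumr (reindex_inj (mulgI g)) /=.
by apply: eq_bigr => h _; rewrite mulKg rmorphM actM mulrA.
Qed.

Definition skew_rank (f : {ffun gT -> S}) : nat := rk_inn (range (skew_eval f)).

Definition min_dist (C : set SG) : nat :=
  least [set r | exists f, [/\ C f, f <> 0 & r = skew_rank f]].

Definition is_MRD (n : nat) (C : set SG) : Prop :=
  [/\ linear_code C, free_submodule C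
    & rk_inn C = (n * (n - min_dist C + 1))%N].

End SkewGroupAlgebra.

Definition coef_reduce (gT : finType) (S k : nzRingType) (pi : {rmorphism S -> k})
  (f : {ffun gT -> S}) : {ffun gT -> k} := [ffun g => pi (f g)].

(* Main.v *)
Require Import Defs.
From HB Require Import structures.
From mathcomp Require Import all_boot all_order all_algebra all_fingroup all_field.
From mathcomp Require Import boolp classical_sets.

Import GRing.Theory.
Local Open Scope classical_set_scope.
Local Open Scope ring_scope.

(** Since R is finite it is a proper quotient of its discrete valuation ring: a
    finite domain would be a field ([dvr_not_finite]). So R and S share a
    nilpotent uniformizer w, with w^(m+1) = 0, the kernel of the residue map
    being both the ideal (w) and the annihilator of w^m
    ([dvr_quotient_uniformizer]). Hence, on S and coefficientwise on S[G],
    multiplication by w^m has the same kernel as reduction: it identifies the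
    reduction of a module with a submodule of the module itself.

    Applied to relations between elements of C, this shows that reduction sends
    an R-basis of C to a basis of the reduced code, and that the elements of C
    reducing to 0 are those of w C ([linearly_independent_reduction]). The rank
    of a free module is well defined, so C and its reduction have equal ranks.

    For the distances, write f' for the reduction of f. As w^m kills exactly the
    kernel of S -> kS, the module (w^m f)(S) has at most as many generators as
    f'(kS), and w^m f is a nonzero element of C when f' is nonzero: this gives
    d(C) <= d(Cbar) ([skew_rank_socle_le]). Conversely a nonzero element of C is
    w^j f with f in C, j <= m and f' nonzero ([primitive_factor]); the elements
    of S killed by w^j reduce to 0, so f'(kS) is a quotient of (w^j f)(S) and
    the rank of w^j f is at least that of f' ([skew_rank_reduce_le]). Both rank
    comparisons are instances of [rk_inn_image_le]. The minimal numbers of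
    generators only mean something for finitely generated modules; S is one
    over R by Nakayama's lemma with the nilpotent w.

    The MRD property is then an equality between equal numbers. *)

Set Implicit Arguments.
Unset Strict Implicit.
Unset Printing Implicit Defensive.

(** * Least elements, submodules and generating families *)

Lemma least_mem (P : set nat) : (exists r, P r) -> P (least P).
Proof.
move=> exP; have exb : exists r, `[< P r >] by case: exP => r Pr; exists r; apply/asboolP.
have [r /asboolP Pr min_r] := ex_minnP exb.
have [|//] := @xgetPex _ 0%N [set r | P r /\ forall m, P m -> (r <= m)%N].
by exists r; split=> // m Pm; apply: min_r; apply/asboolP.
Qed.

Lemma least_le (P : set nat) r : P r -> (least P <= r)%N.
Proof.
rewrite /least => Pr; case: xgetP => [m _ [_ min_m]|no_min] //.
exact: min_m.
Qed.

Lemma submoduleP (R : nzRingType) (V : lmodType R) (M : set V) :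
  is_submodule M <-> M 0 /\ forall a u v, M u -> M v -> M (a *: u + v).
Proof.
split=> [[M0 MZD]|[M0 MZD]].
  split=> [|a u v Mu Mv]; first by rewrite !inE in M0.
  by have := MZD a u v; rewrite !inE; apply.
by split=> [|a u v]; rewrite !inE //; apply: MZD.
Qed.

Lemma submodule_sum (R : nzRingType) (V : lmodType R) (M : set V) r
    (a : 'I_r -> R) (e : 'I_r -> V) :
  is_submodule M -> (forall i, M (e i)) -> M (\sum_i a i *: e i).
Proof.
move=> /submoduleP[M0 MZD] Me.
have MD u v : M u -> M v -> M (u + v) by move=> Mu Mv; rewrite -[u]scale1r; apply: MZD.
elim/big_ind: _ => // i _.
by rewrite -[_ *: _]addr0; apply: MZD.
Qed.

Definition finitely_generated (R : comNzRingType) (V : lmodType R) (M : set V) :=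
  exists r (e : 'I_r -> V), M = spanned e.

Lemma spanned_gen (R : comNzRingType) (V : lmodType R) r (e : 'I_r -> V) i :
  spanned e (e i).
Proof.
exists (fun j => (j == i)%:R) => //.
by rewrite (bigD1 i) //= eqxx scale1r big1 ?addr0 // => j /negPf->; rewrite scale0r.
Qed.

Lemma rk_inn_gen (R : comNzRingType) (V : lmodType R) (M : set V) :
  finitely_generated M -> exists e : 'I_(rk_inn M) -> V, M = spanned e.
Proof. exact: (@least_mem [set r | exists e : 'I_r -> V, M = spanned e]). Qed.

Lemma rk_inn_le (R : comNzRingType) (V : lmodType R) r (e : 'I_r -> V) :
  (rk_inn (spanned e) <= r)%N.
Proof. by apply: least_le; exists e. Qed.

(** Comparing two families through their transition matrices A and B, linear
    independence forces A B = 1; over the field k the ranks bound r by s. *)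
Lemma rk_inn_free (R : comNzRingType) (V : lmodType R) (k : fieldType)
    (pi : {rmorphism R -> k}) r (e : 'I_r -> V) :
  linearly_independent e -> rk_inn (spanned e) = r.
Proof.
move=> e_free; apply/eqP; rewrite eqn_leq rk_inn_le /=.
have [|f ef] := @rk_inn_gen _ _ (spanned e); first by exists r, e.
have /choice[A eA] i : exists a : 'I_(rk_inn (spanned e)) -> R, e i = \sum_j a j *: f j.
  by have := spanned_gen e i; rewrite {1}ef => -[a _ <-]; exists a.
have /choice[B fB] j : exists b : 'I_r -> R, f j = \sum_i b i *: e i.
  by have := spanned_gen f j; rewrite -ef => -[b _ <-]; exists b.
set s := rk_inn _ in f ef A eA B fB *.
pose MA := \matrix_(i < r, j < s) A i j; pose MB := \matrix_(j < s, i < r) B j i.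
have MAB : MA *m MB = 1%:M.
  apply/matrixP=> i l; rewrite !mxE; apply/eqP; rewrite -subr_eq0; apply/eqP.
  under eq_bigr => j _ do rewrite !mxE.
  apply: (e_free (fun l => \sum_j A i j * B j l - (i == l)%:R)).
  under eq_bigr => l' _ do rewrite scalerBl scaler_suml.
  rewrite sumrB exchange_big /=.
  under eq_bigr => j _ do under eq_bigr => l' _ do rewrite -scalerA.
  under eq_bigr => j _ do rewrite -scaler_sumr -fB.
  rewrite -eA (bigD1 i) //= eqxx scale1r big1 ?addr0 ?subrr // => l' /negPf il.
  by rewrite eq_sym il scale0r.
have := mulmx_max_rank (map_mx pi MA) (map_mx pi MB).
by rewrite -map_mxM MAB map_mx1 mxrank1.
Qed.

(** * Semilinear images *)

Section Semilinear.
Variables (R R' : comNzRingType) (s : {rmorphism R -> R'}).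
Variables (V : lmodType R) (V' : lmodType R') (q : V -> V').
Hypothesis q_lin : GRing.linear_for (s \; *:%R) q.

Lemma semilinear0 : q 0 = 0.
Proof.
have := q_lin 1 0 0; rewrite scale1r addr0 /= rmorph1 scale1r => q0.
by apply: (addIr (q 0)); rewrite -q0 add0r.
Qed.

Lemma semilinearD x y : q (x + y) = q x + q y.
Proof. by rewrite -[x in LHS]scale1r q_lin /= rmorph1 scale1r. Qed.

Lemma semilinearZ a x : q (a *: x) = s a *: q x.
Proof. by rewrite -[_ *: x]addr0 q_lin semilinear0 addr0. Qed.

Lemma semilinearB x y : q (x - y) = q x - q y.
Proof. by rewrite semilinearD -scaleN1r semilinearZ rmorphN1 scaleN1r. Qed.

Lemma semilinear_sum r (a : 'I_r -> R) (e : 'I_r -> V) :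
  q (\sum_i a i *: e i) = \sum_i s (a i) *: q (e i).
Proof.
rewrite (big_morph q semilinearD semilinear0).
by apply: eq_bigr => i _; rewrite semilinearZ.
Qed.

Hypothesis s_surj : range s = setT.

Lemma surj_family r (a : 'I_r -> R') : exists b : 'I_r -> R, a = s \o b.
Proof.
have /choice[b sb] i : exists b, s b = a i.
  by have : range s (a i) by [rewrite s_surj]; case=> b _ <-; exists b.
by exists b; apply/funext => i /=; rewrite sb.
Qed.

Lemma submodule_image (M : set V) : is_submodule M -> is_submodule (q @` M).
Proof.
move=> /submoduleP[M0 MZD]; apply/submoduleP.
split=> [|a' _ _ [u Mu <-] [v Mv <-]]; first by exists 0 => //; exact: semilinear0.
have : range s a' by rewrite s_surj.
case=> a _ <-; exists (a *: u + v); [exact: MZD|exact: q_lin].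
Qed.

Lemma image_spanned r (e : 'I_r -> V) : q @` spanned e = spanned (q \o e).
Proof.
apply/seteqP; split=> [_ [_ [a _ <-] <-]|_ [a _ <-]].
  by exists (s \o a) => //; rewrite semilinear_sum.
have [b ->] := surj_family a.
by exists (\sum_i b i *: e i); [exists b|rewrite semilinear_sum].
Qed.

Lemma finitely_generated_image (M : set V) :
  finitely_generated M -> finitely_generated (q @` M).
Proof. by move=> [r [e ->]]; exists r, (q \o e); rewrite image_spanned. Qed.

(** Nakayama for a nilpotent w: lifts of generators of q(V) generate V modulo
    w V, hence modulo every power of w. *)
Lemma finitely_generated_lift (w : R) m :
  w ^+ m = 0 -> (forall x, q x = 0 -> exists y, x = w *: y) ->
  range q = setT -> finitely_generated [set: V'] -> finitely_generated [set: V].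
Proof.
move=> wm0 kerq q_surj [r [e' e'_gen]].
have /choice[e qe] i : exists x, q x = e' i.
  by have : range q (e' i) by [rewrite q_surj]; case=> x _ <-; exists x.
exists r, e; apply/seteqP; split=> // y _.
suff /(_ m y)[a [z ->]] : forall j y, exists a z, y = \sum_i a i *: e i + w ^+ j *: z.
  by exists a => //; rewrite wm0 scale0r addr0.
elim=> [x|j IHj x].
  by exists (fun=> 0), x; rewrite big1 ?add0r ?expr0 ?scale1r // => i _; rewrite scale0r.
have [a [z ->]] := IHj x.
have : spanned e' (q z) by rewrite -e'_gen.
case=> b' _; have [b ->] := surj_family b'; move=> qz.
have [|t zt] := kerq (z - \sum_i b i *: e i).
  by rewrite semilinearB semilinear_sum -qz; under [X in _ - X]eq_bigr => i _ do rewrite qe; rewrite subrr.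
exists (fun i => a i + w ^+ j * b i), t.
rewrite exprSr -scalerA -zt scalerBr scaler_sumr.
under [in RHS]eq_bigr => i _ do rewrite scalerDl -scalerA.
by rewrite big_split /= -addrA; congr (_ + _); rewrite addrC subrK.
Qed.

End Semilinear.

(** When ker q1 lies in ker q2, the map q1 x |-> q2 x is well defined, so the
    image under q2 is a semilinear quotient of the image under q1. *)
Lemma rk_inn_image_le (R R1 R2 : comNzRingType)
    (s1 : {rmorphism R -> R1}) (s2 : {rmorphism R -> R2})
    (V : lmodType R) (V1 : lmodType R1) (V2 : lmodType R2)
    (q1 : V -> V1) (q2 : V -> V2) (M : set V) :
  GRing.linear_for (s1 \; *:%R) q1 -> GRing.linear_for (s2 \; *:%R) q2 ->
  range s1 = setT -> range s2 = setT -> (forall x, q1 x = 0 -> q2 x = 0) ->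
  is_submodule M -> finitely_generated (q1 @` M) ->
  (rk_inn (q2 @` M) <= rk_inn (q1 @` M))%N.
Proof.
move=> q1_lin q2_lin s1_surj s2_surj ker12 subM /rk_inn_gen[e q1M].
have /choice[x xP] i : exists x, M x /\ q1 x = e i.
  by have := spanned_gen e i; rewrite -q1M => -[x Mx <-]; exists x.
suff -> : q2 @` M = spanned (q2 \o x) by exact: rk_inn_le.
apply/seteqP; split=> [_ [y My <-]|_ [a _ <-]].
  have : spanned e (q1 y) by rewrite -q1M; exists y.
  case=> a _; have [b ->] := surj_family s1_surj a => q1y.
  exists (s2 \o b) => //=; rewrite -(semilinear_sum q2_lin); apply/eqP.
  rewrite eq_sym -subr_eq0 -(semilinearB q2_lin); apply/eqP/ker12.
  rewrite (semilinearB q1_lin) (semilinear_sum q1_lin) -q1y.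
  by under [X in _ - X]eq_bigr => i _ do rewrite (xP i).2; rewrite subrr.
have [b ->] := surj_family s2_surj a.
exists (\sum_i b i *: x i); last exact: (semilinear_sum q2_lin).
by apply: submodule_sum => // i; case: (xP i).
Qed.

(** * Residue maps of quotients of discrete valuation rings *)

(** An intrinsic form of being the quotient of a discrete valuation ring by the
    (m+1)-st power of its uniformizer, shared by R with w and S with w%:A:
    w^m generates the socle, on which the ring acts through its residue field. *)
Definition nilpotent_uniformizer (A : comNzRingType) (k : fieldType)
    (pi : {rmorphism A -> k}) (w : A) (m : nat) : Prop :=
  [/\ range pi = setT, w ^+ m.+1 = 0, forall x, pi x = 0 -> exists y, x = w * y
    & forall x, w ^+ m * x = 0 -> pi x = 0].

Lemma nilpotent_uniformizer_ann (A : comNzRingType) (k : fieldType)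
    (pi : {rmorphism A -> k}) (w : A) m x :
  nilpotent_uniformizer pi w m -> w ^+ m * x = 0 <-> pi x = 0.
Proof.
case=> _ wm0 kerpi annw; split=> [|/kerpi[y ->]]; first exact: annw.
by rewrite mulrA -exprSr wm0 mul0r.
Qed.

Lemma uniformizer_exp_neq0 (A : comNzRingType) (w : A) j :
  dvr A -> maximal_ideal (principal_ideal w) -> w ^+ j <> 0.
Proof.
case=> idA _ _ not_field maxw; elim: j => [|j IHj].
  by rewrite expr0; apply/eqP/oner_neq0.
rewrite exprS => /idA/orP[]/eqP// w0; apply: not_field; congr maximal_ideal: maxw.
rewrite w0; apply/seteqP; split=> [x [y ->]|x ->] /=; first by rewrite mulr0.
by exists 0; rewrite mul0r.
Qed.

Lemma not_unit_uniformizer (A : comNzRingType) (w : A) y :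
  maximal_ideal (principal_ideal w) -> y * w <> 1.
Proof.
case=> _ w_proper _ yw1; apply: w_proper; apply/seteqP; split=> // x _.
by exists (x * y); rewrite -mulrA yw1 mulr1.
Qed.

(** Comaximality: an element outside the maximal ideal (w) generates the unit
    ideal together with w. *)
Lemma maximal_ideal_bezout (A : comNzRingType) (w x : A) :
  maximal_ideal (principal_ideal w) -> ~ principal_ideal w x ->
  exists a b, a * x + b * w = 1.
Proof.
case=> _ w_proper w_max wNx.
pose J : set A := [set z | exists a b, a * x + b * w = z].
have subJ : is_ideal J.
  apply/submoduleP; split=> [|c _ _ [a [b <-]] [a' [b' <-]]].
    by exists 0, 0; rewrite !mul0r addr0.
  exists (c * a + a'), (c * b + b'); rewrite !mulrDl -!mulrA addrACA -mulrDr.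
  by [].
have wJ : principal_ideal w `<=` J.
  by move=> _ [y ->]; exists 0, y; rewrite mul0r add0r.
have [|JT] := pselect (J = setT).
  by move=> JT; have : J 1 by rewrite JT.
case: wNx; rewrite -(w_max J subJ wJ JT).
by exists 1, 0; rewrite mul1r mul0r addr0.
Qed.

Lemma dvr_quotient_uniformizer (At A : comNzRingType) (k : fieldType)
    (p : {rmorphism At -> A}) (pi : {rmorphism A -> k}) (w : At) m :
  dvr At -> maximal_ideal (principal_ideal w) ->
  range p = setT -> range pi = setT ->
  [set x | p x = 0] = principal_ideal (w ^+ m.+1) ->
  nilpotent_uniformizer pi (p w) m.
Proof.
move=> dvrA maxw p_surj pi_surj kerp.
have [idA _ _ _] := dvrA.
have pwm0 : p w ^+ m.+1 = 0.
  have : [set x | p x = 0] (w ^+ m.+1) by rewrite kerp; exists 1; rewrite mul1r.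
  by rewrite /= rmorphXn.
have piw0 : pi (p w) = 0.
  by have /eqP := congr1 pi pwm0; rewrite rmorphXn rmorph0 expf_eq0 => /eqP.
have lift x : exists xt, p xt = x.
  by have : range p x by [rewrite p_surj]; case=> xt _ <-; exists xt.
have wexp0 j := uniformizer_exp_neq0 (j := j) dvrA maxw.
split=> // x; have [xt <-] := lift x.
  move=> pix0; have [[y ->]|wNx] := pselect (principal_ideal w xt).
    by exists (p y); rewrite rmorphM mulrC.
  have [a [b /(congr1 (pi \o p))]] := maximal_ideal_bezout maxw wNx.
  rewrite /= !(rmorph1, rmorphD, rmorphM) pix0 piw0 !mulr0 addr0 => /eqP.
  by rewrite eq_sym oner_eq0.
rewrite -rmorphXn -rmorphM => pwx0.
have : principal_ideal (w ^+ m.+1) (w ^+ m * xt) by rewrite -kerp.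
case=> y wxy; have /idA/orP[/eqP/wexp0//|] : w ^+ m * (xt - y * w) = 0.
  by rewrite mulrBr wxy exprSr mulrCA subrr.
by rewrite subr_eq0 => /eqP->; rewrite !rmorphM piw0 mulr0.
Qed.

(** A finite domain is a field: two powers of w coincide, which makes w a unit. *)
Lemma dvr_not_finite (A : comNzRingType) (F : finComNzRingType)
    (p : {rmorphism A -> F}) (w : A) :
  dvr A -> maximal_ideal (principal_ideal w) -> [set a | p a = 0] <> [set 0].
Proof.
move=> dvrA maxw kerp; have [idA _ _ _] := dvrA.
have p_inj a b : p a = p b -> a = b.
  move=> pab; apply/eqP; rewrite -subr_eq0; apply/eqP.
  have : [set a | p a = 0] (a - b) by rewrite /= rmorphB pab subrr.
  by rewrite kerp.
have wexp0 j := uniformizer_exp_neq0 (j := j) dvrA maxw.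
have /injectivePn[i [j ij pij]] : ~~ injectiveb (fun i : 'I_#|F|.+1 => p (w ^+ i)).
  by apply/negP=> /injectiveP/leq_card; rewrite card_ord ltnn.
wlog ltij : i j ij pij / (i < j)%N.
  move=> th; case: (ltngtP i j) => [|ji|/val_inj eij]; first exact: th.
    by apply: (th j i); rewrite // eq_sym.
  by rewrite eij eqxx in ij.
have /eqP := p_inj _ _ pij; rewrite -(subnKC ltij) addSnnS exprD.
rewrite -[X in X == _]mulr1 -subr_eq0 -mulrBr => /eqP/idA/orP[/eqP/wexp0//|].
by rewrite subr_eq0 exprSr => /eqP/esym; apply: not_unit_uniformizer.
Qed.

(** * Reduction of free submodules *)

Section FreeReduction.
Variables (R : comNzRingType) (kR : fieldType) (piR : {rmorphism R -> kR}).
Variables (w : R) (m : nat).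
Hypothesis unif : nilpotent_uniformizer piR w m.
Variables (V : lmodType R) (kV : lmodType kR) (q : V -> kV).
Hypothesis q_lin : GRing.linear_for (piR \; *:%R) q.
Hypothesis kerq : forall v, w ^+ m *: v = 0 <-> q v = 0.

(** A relation between the reductions lifts to a combination killed by w^m,
    whose coefficients are then killed by w^m, that is, lie in ker piR. *)
Lemma linearly_independent_reduction r (e : 'I_r -> V) :
  linearly_independent e -> linearly_independent (q \o e).
Proof.
move=> e_free a'; have [pi_surj _ _ _] := unif.
have [a ->] := surj_family pi_surj a'; rewrite -(semilinear_sum q_lin).
move/kerq; rewrite scaler_sumr => ae0 i.
apply/(nilpotent_uniformizer_ann _ unif).
apply: (e_free (fun i => w ^+ m * a i)); rewrite -[RHS]ae0.
by apply: eq_bigr => j _; rewrite scalerA.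
Qed.

(** The elements of a free submodule M that reduce to 0 lie in w M, so one can
    divide by w inside M until the reduction is nonzero. *)
Lemma primitive_factor (M : set V) f :
  free_submodule M -> M f -> f <> 0 ->
  exists2 j, (j <= m)%N & exists2 f', M f' & f = w ^+ j *: f' /\ q f' <> 0.
Proof.
move=> [r [e [e_free ->]]] Mf f0; have [_ wm0 kerpi _] := unif.
have expw0 j v : f = w ^+ j *: v -> (j <= m)%N.
  move=> fE; rewrite leqNgt; apply/negP=> mj; apply: f0.
  by rewrite fE -(subnKC mj) exprD wm0 mul0r scale0r.
apply: contrapT => no_factor.
suff /(_ m.+1)[f' _ /expw0] : forall j, exists2 f', spanned e f' & f = w ^+ j *: f'.
  by rewrite ltnn.
elim=> [|j [f' Mf' fE]]; first by exists f; rewrite ?expr0 ?scale1r.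
have [qf'|] := pselect (q f' = 0); last first.
  by move=> qf'; case: no_factor; exists j; [exact: expw0 fE|exists f'].
case: Mf' fE qf' => a _ <- fE; rewrite (semilinear_sum q_lin).
move=> /(linearly_independent_reduction e_free) /= a0.
have /choice[b ab] i : exists b, a i = w * b by exact: kerpi.
exists (\sum_i b i *: e i); first by exists b.
rewrite fE exprSr -scalerA; congr (_ *: _); rewrite scaler_sumr.
by apply: eq_bigr => i _; rewrite ab scalerA.
Qed.

End FreeReduction.

(** * Ranks in the skew group algebra *)

Section SkewReduction.
Variables (gT : finGroupType) (R : comNzRingType) (S : comAlgType R).
Variables (act : gT -> {lrmorphism S -> S}).
Variables (kR : fieldType) (kS : fieldExtType kR).
Variables (piR : {rmorphism R -> kR}) (piS : {rmorphism S -> kS}).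
Variable (kact : gT -> {lrmorphism kS -> kS}).
Variables (w : R) (m : nat).
Hypothesis unifR : nilpotent_uniformizer piR w m.
Hypothesis unifS : nilpotent_uniformizer piS (w%:A) m.
Hypothesis piSA : forall a : R, piS a%:A = (piR a)%:A.
Hypothesis piS_act : forall g x, piS (act g x) = kact g (piS x).

Local Notation SG := (skew_group_algebra gT S).
Local Notation kSG := (skew_group_algebra gT kS).
Local Notation reduce := (coef_reduce piS : SG -> kSG).

Lemma skew_eval_linear f : GRing.linear_for (idfun \; *:%R) (skew_eval act f).
Proof.
move=> a x y; rewrite /skew_eval /= scaler_sumr -big_split /=.
by apply: eq_bigr => g _; rewrite linearP mulrDr -scalerAr.
Qed.

Lemma skew_evalZ a (f : SG) x : skew_eval act (a *: f) x = a *: skew_eval act f x.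
Proof.
by rewrite /skew_eval scaler_sumr; apply: eq_bigr => g _; rewrite ffunE scalerAl.
Qed.

Lemma skew_eval_reduce f x :
  piS (skew_eval act f x) = skew_eval kact (coef_reduce piS f) (piS x).
Proof.
rewrite /skew_eval rmorph_sum; apply: eq_bigr => g _.
by rewrite ffunE rmorphM piS_act.
Qed.

Lemma residue_semilinear : GRing.linear_for (piR \; *:%R) piS.
Proof.
by move=> a x y; rewrite rmorphD -[a *: x]mulr_algl rmorphM piSA mulr_algl.
Qed.

Lemma coef_reduce_semilinear : GRing.linear_for (piR \; *:%R) reduce.
Proof. by move=> a f g; apply/ffunP=> h; rewrite !ffunE residue_semilinear. Qed.

Lemma scale_uniformizer_ann x : w ^+ m *: x = 0 <-> piS x = 0.
Proof.
rewrite -(nilpotent_uniformizer_ann _ unifS).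
suff -> : (w%:A : S) ^+ m = (w ^+ m)%:A by rewrite mulr_algl.
by rewrite -!in_algE rmorphXn.
Qed.

Lemma scale_uniformizer_ann_coef (f : SG) : w ^+ m *: f = 0 <-> reduce f = 0.
Proof.
split=> /ffunP f0; apply/ffunP=> g; have := f0 g; rewrite !ffunE.
  exact: (scale_uniformizer_ann _).1.
exact: (scale_uniformizer_ann _).2.
Qed.

Lemma range_residue : range piS = setT. Proof. by case: unifS. Qed.

Lemma finitely_generated_extension : finitely_generated [set: S].
Proof.
have [piR_surj wm0 _ _] := unifR; have [piS_surj _ kerpiS _] := unifS.
apply: (finitely_generated_lift residue_semilinear piR_surj wm0) => // [x /kerpiS[y ->]|].
  by exists y; rewrite mulr_algl.
exists (\dim {:kS}), (fun i => (vbasis {:kS})`_i); apply/seteqP; split=> // y _.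
by exists (fun i => coord (vbasis {:kS}) i y); rewrite // -coord_vbasis ?memvf.
Qed.

Lemma range_skew_eval_submodule f : is_submodule (range (skew_eval act f)).
Proof.
apply: (submodule_image (skew_eval_linear f)) => //.
  by apply/seteqP; split=> // x _; exists x.
exact/submoduleP.
Qed.

Lemma range_skew_eval_fg f : finitely_generated (range (skew_eval act f)).
Proof.
apply: (finitely_generated_image (skew_eval_linear f)) finitely_generated_extension.
by apply/seteqP; split=> // x _; exists x.
Qed.

Lemma range_skew_evalZ a (f : SG) :
  range (skew_eval act (a *: f)) = *:%R a @` range (skew_eval act f).
Proof.
apply/seteqP; split=> [_ [x _ <-]|_ [_ [x _ <-] <-]].
  by exists (skew_eval act f x); [exists x|rewrite skew_evalZ].
by exists x; rewrite ?skew_evalZ.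
Qed.

Lemma range_skew_eval_reduce f :
  range (skew_eval kact (coef_reduce piS f)) = piS @` range (skew_eval act f).
Proof.
apply/seteqP; split=> [_ [x _ <-]|_ [_ [x _ <-] <-]].
  have : range piS x by rewrite range_residue.
  case=> y _ <-; exists (skew_eval act f y); first by exists y.
  exact: skew_eval_reduce.
by exists (piS x); rewrite ?skew_eval_reduce.
Qed.

Lemma scale_linear a : GRing.linear_for (idfun \; *:%R) ( *:%R a : S -> S).
Proof. by move=> b x y; rewrite scalerDr /= !scalerA mulrC. Qed.

(** For j <= m, the kernel of multiplication by w^j lies in ker piS, so w^j f(S)
    maps onto the reduction of f(S). *)
Lemma skew_rank_reduce_le j (f : SG) : (j <= m)%N ->
  (skew_rank kact (coef_reduce piS f) <= skew_rank act (w ^+ j *: f))%N.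
Proof.
move=> jm; have [piR_surj _ _ _] := unifR.
rewrite /skew_rank range_skew_eval_reduce range_skew_evalZ.
apply: (rk_inn_image_le (scale_linear _) residue_semilinear) => //.
- by apply/seteqP; split=> // x _; exists x.
- move=> x wjx0; apply/scale_uniformizer_ann.
  by rewrite -(subnK jm) exprD -scalerA wjx0 scaler0.
- exact: range_skew_eval_submodule.
- by rewrite -range_skew_evalZ; apply: range_skew_eval_fg.
Qed.

(** Multiplication by w^m kills ker piS, so it factors through the reduction. *)
Lemma skew_rank_socle_le (f : SG) :
  (skew_rank act (w ^+ m *: f) <= skew_rank kact (coef_reduce piS f))%N.
Proof.
have [piR_surj _ _ _] := unifR.
rewrite /skew_rank range_skew_eval_reduce range_skew_evalZ.
apply: (rk_inn_image_le residue_semilinear (scale_linear _)) => //.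
- by apply/seteqP; split=> // x _; exists x.
- by move=> x /scale_uniformizer_ann.
- exact: range_skew_eval_submodule.
- exact: (finitely_generated_image residue_semilinear piR_surj (range_skew_eval_fg f)).
Qed.

Variable C : set SG.
Hypothesis C_code : linear_code C.
Hypothesis C_free : free_submodule C.

Lemma code_nonzero : exists2 f, C f & f <> 0.
Proof.
have [/submoduleP[C0 _] Cn0] := C_code.
apply: contrapT => no_f; apply: Cn0; apply/seteqP; split=> [f Cf|_ -> //].
by apply: contrapT => f0; apply: no_f; exists f.
Qed.

Lemma min_dist_reduce : min_dist act C = min_dist kact (reduce @` C).
Proof.
have [/submoduleP[C0 CZD] _] := C_code.
have factor f := primitive_factor unifR coef_reduce_semilinear
  scale_uniformizer_ann_coef C_free (f := f).
have [f Cf f0] := code_nonzero.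
apply/eqP; rewrite /min_dist eqn_leq; apply/andP; split.
  have [|_ [[h Ch <-] h0 ->]] := @least_mem
    [set r | exists f, [/\ (reduce @` C) f, f <> 0 & r = skew_rank kact f]].
    have [j _ [f' Cf' [_ f'0]]] := factor f Cf f0.
    by exists (skew_rank kact (reduce f')), (reduce f'); split=> //; exists f'.
  apply: leq_trans (skew_rank_socle_le h); apply: least_le.
  exists (w ^+ m *: h); split=> //; last by move/scale_uniformizer_ann_coef.
  by rewrite -[_ *: h]addr0; apply: CZD.
have [|h [Ch h0 ->]] := @least_mem
  [set r | exists f, [/\ C f, f <> 0 & r = skew_rank act f]].
  by exists (skew_rank act f), f.
have [j jm [h' Ch' [-> h'0]]] := factor h Ch h0.
apply: leq_trans (skew_rank_reduce_le h' jm); apply: least_le.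
by exists (reduce h'); split=> //; exists h'.
Qed.

Lemma reduce_free_basis : exists r (e : 'I_r -> kSG),
  [/\ linearly_independent e, reduce @` C = spanned e & rk_inn C = r].
Proof.
have [piR_surj _ _ _] := unifR; have [r [e [e_free CE]]] := C_free.
exists r, (reduce \o e); split.
- exact: (linearly_independent_reduction unifR coef_reduce_semilinear
    scale_uniformizer_ann_coef).
- by rewrite CE (image_spanned coef_reduce_semilinear).
- by rewrite CE (rk_inn_free piR).
Qed.

Lemma linear_code_reduce : linear_code (reduce @` C).
Proof.
have [piR_surj _ _ _] := unifR; have [subC _] := C_code.
split; first exact: (submodule_image coef_reduce_semilinear).
have [f Cf f0] := code_nonzero.
have [j _ [h Ch [_ h0]]] := primitive_factor unifR coef_reduce_semilinear
  scale_uniformizer_ann_coef C_free Cf f0.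
move=> C0; apply: h0; have : (reduce @` C) (reduce h) by exists h.
by rewrite C0.
Qed.

End SkewReduction.

(** * Codes over the residue field *)

Lemma spanned_vspace (K : fieldType) (vT : vectType K) r (e : 'I_r -> vT) :
  linearly_independent e ->
  exists U : {vspace vT}, [set v | v \in U] = spanned e /\ \dim U = r.
Proof.
move=> e_free; pose X := [tuple e i | i < r].
have XE (i : 'I_r) : X`_i = e i by rewrite (nth_map i) ?size_enum_ord // nth_ord_enum.
have XP v : reflect (exists a : 'I_r -> K, \sum_i a i *: e i = v) (v \in <<X>>%VS).
  apply: (iffP idP) => [/(@coord_span _ _ _ X)->|[a <-]].
    by exists (fun i => coord X i v); apply: eq_bigr => i _; rewrite XE.
  by apply: memv_suml => i _; rewrite memvZ // -XE memv_span // mem_nth // size_tuple.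
exists <<X>>%VS; split.
  by apply/seteqP; split=> [v /XP[a <-]|_ [a _ <-]]; [exists a|apply/XP; exists a].
have : free X.
  by apply/freeP => a; under eq_bigr => i _ do rewrite XE; exact: e_free.
by rewrite /free size_tuple => /eqP.
Qed.

Unset Implicit Arguments.

Theorem theorem2p25 (gT : finGroupType) (sigma : gT) (n : nat)
    (R : finComNzRingType) (S : comAlgType R) (act : gT -> {lrmorphism S -> S})
    (kR : fieldType) (kS : fieldExtType kR)
    (piR : {rmorphism R -> kR}) (piS : {rmorphism S -> kS})
    (kact : gT -> {lrmorphism kS -> kS})
    (C : set (skew_group_algebra gT S)) :
  (forall g : gT, g \in <[sigma]>%g) -> #[sigma]%g = n ->
  unramified_galois act ->
  residue_map piR -> residue_map piS ->
  (forall a : R, piS a%:A = (piR a)%:A) ->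
  (forall g x, piS (act g x) = kact g (piS x)) ->
  linear_code C -> free_submodule C ->
  let Cbar : set (skew_group_algebra gT kS) := coef_reduce piS @` C in
  [/\ min_dist act C = min_dist kact Cbar,
      exists U : {vspace {ffun gT -> kS}},
        [set f | f \in U] = Cbar /\ rk_inn C = \dim U
    & is_MRD act n C <-> is_MRD kact n Cbar].
Proof.
move=> _ _ [Rt [St [actt [w [pR [pS unram]]]]]] [piR_surj _] [piS_surj _] piSA piS_act.
case: unram => -[dvrR dvrS _] [maxw maxwS] [pR_surj pS_surj] [pSA _] kers C_code C_free Cbar.
have [m unifR unifS] : exists2 m, nilpotent_uniformizer piR (pR w) m
    & nilpotent_uniformizer piS (pR w)%:A m.
  case: kers => [[kerR _]|[[|m] [// _ kerR kerS]]].
    by case: (dvr_not_finite dvrR maxw kerR).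
  exists m; first exact: dvr_quotient_uniformizer dvrR maxw pR_surj piR_surj kerR.
  rewrite -pSA; apply: dvr_quotient_uniformizer dvrS maxwS pS_surj piS_surj _.
  by rewrite kerS -!in_algE rmorphXn.
have [r [e [e_free CbarE rkC]]] := reduce_free_basis unifR unifS piSA C_free.
have dE := min_dist_reduce unifR unifS piSA piS_act C_code C_free.
have rkE : rk_inn C = rk_inn Cbar by rewrite rkC /Cbar CbarE (rk_inn_free idfun).
split=> //.
  by have [U [UE dimU]] := spanned_vspace e_free; exists U; rewrite UE dimU -CbarE.
split=> -[_ _ rk_MRD]; last by split=> //; rewrite rkE dE.
split; last by rewrite -rkE -dE.
  exact: (linear_code_reduce unifR unifS piSA C_code C_free).
by exists r, e.
Qed.
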